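(* Let $R>0$ and let $f(z)=\sum_{n=0}^{+\infty}a_nz^n$ be a complex power series convergent in $D(0;R)$. For every $r$ with $0\le r<R$ we have $$\sum_{n=0}^{+\infty}|a_n|^2r^{2n}\le M(r)^2,\qquad\text{where } M(r)=\max_{|z|=r}|f(z)|.$$
   Context: $D(0;R)=\{z\in\mathbb{C}:|z|<R\}$. The convention $0^0=1$ is used in the $n=0$ term. *)

(* Defs.v *)
From Stdlib Require Import Reals.
From Coquelicot Require Import Coquelicot.
Open Scope R_scope.

Definition is_maximum (E : R -> Prop) (m : R) : Prop :=
  E m /\ is_upper_bound E m.

Definition modulus_on_circle (f : C -> C) (r : R) : R -> Prop :=
  fun y => exists z : C, Cmod z = r /\ y = Cmod (f z).

(* Main.v *)
Require Import Defs.
From Stdlib Require Import Reals Lra Lia.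
From Coquelicot Require Import Coquelicot.
Open Scope R_scope.

(** On the circle of radius [r] the monomials are orthogonal, so the mean of
    [|f|^2] is the sum of the [|a n|^2 r^(2n)], and a mean of [|f|^2] cannot
    exceed its maximum.

    The mean can be taken over finitely many points. For a polynomial [P] of
    degree at most [N], the mean of [|P|^2] over the [N + 1] points
    [r * cis (2 pi k / (N + 1))] is exactly the sum of the
    [|a n|^2 r^(2n)] for [n <= N]: distinct powers of degree at most [N] are
    orthogonal on the [(N + 1)]-st roots of unity ([roots_orthogonal]), and the
    rest is the theorem of Pythagoras ([pythagoras], [partial_sum_parseval]).
    Hence this sum is at most [B^2] as soon as [|P| <= B] on the circle
    ([sum_sqr_le]).

    The series converges absolutely at radius [r] ([pseries_abs_converges]), so
    on the circle the [N]-th partial sum differs from [f] by at most the tail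
    of a convergent series of constants ([partial_sum_approx]). With [M] the
    maximum of [|f|], this gives partial sums at most [(M + tail N)^2], and
    [N] tends to infinity.

    The maximum exists because [t |-> |f (r * cis t)|] is a uniform limit of
    continuous functions ([modulus_continuous]) and [- PI <= t <= PI] already
    covers the circle ([polar_form]). *)

(* Equations between sums are typed in the carrier of an abelian monoid;
   [ring] needs them stated in the convertible type [K]. *)
Ltac ring_in K := lazymatch goal with |- ?u = ?v => change (@eq K u v); ring end.

(** * Points of a circle *)

Definition cis (t : R) : C := (cos t, sin t).

Lemma cis_plus (s t : R) : cis (s + t) = (cis s * cis t)%C.
Proof.
  unfold cis, Cmult; simpl.
  rewrite cos_plus, sin_plus.
  f_equal; ring.
Qed.

Lemma cis_pow (t : R) (n : nat) : (cis t ^ n)%C = cis (INR n * t).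
Proof.
  induction n as [|n IH].
  - simpl. unfold cis. rewrite Rmult_0_l, cos_0, sin_0. reflexivity.
  - rewrite Cpow_S, IH, <- cis_plus, S_INR.
    f_equal; ring.
Qed.

Lemma Cmod_cis (t : R) : Cmod (cis t) = 1.
Proof.
  unfold Cmod, cis; simpl.
  replace (cos t * (cos t * 1) + sin t * (sin t * 1)) with 1.
  - apply sqrt_1.
  - pose proof (sin2_cos2 t) as H. unfold Rsqr in H. lra.
Qed.

Lemma Cmod_scal_cis (r t : R) : 0 <= r -> Cmod (r * cis t) = r.
Proof.
  intros hr.
  rewrite Cmod_mult, Cmod_cis, Cmod_R, Rabs_pos_eq by exact hr.
  ring.
Qed.

Lemma Cmod_le_Rabs (z : C) : Cmod z <= Rabs (fst z) + Rabs (snd z).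
Proof.
  replace z with (RtoC (fst z) + Ci * RtoC (snd z))%C at 1.
  - eapply Rle_trans; [apply Cmod_triangle|].
    rewrite Cmod_mult, !Cmod_R, Cmod_Ci. lra.
  - destruct z as [x y].
    unfold Cplus, Cmult, Ci, RtoC; simpl.
    f_equal; ring.
Qed.

(** The angle is [acos (Re z / |z|)], with the sign of [Im z]. *)
Lemma polar_form (z : C) :
  exists t : R, - PI <= t <= PI /\ z = (Cmod z * cis t)%C.
Proof.
  destruct (Req_dec (Cmod z) 0) as [h0|hn].
  - exists 0. split; [pose proof PI_RGT_0; lra|].
    rewrite h0, (Cmod_eq_0 _ h0). ring.
  - assert (hpos : 0 < Cmod z) by (pose proof (Cmod_ge_0 z); lra).
    destruct z as [x y].
    set (r := Cmod (x, y)) in *.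
    assert (hsq : x * x + y * y = r * r).
    { unfold r, Cmod. rewrite sqrt_sqrt; simpl; nra. }
    set (u := x / r).
    assert (hx : x = r * u) by (unfold u; field; lra).
    assert (hy : Rsqr (y / r) = 1 - Rsqr u).
    { unfold u, Rsqr. apply Rmult_eq_reg_l with (r * r); [|nra].
      field_simplify; nra. }
    assert (hu : -1 <= u <= 1).
    { pose proof (Rle_0_sqr (y / r)). unfold Rsqr in *. nra. }
    pose proof (acos_bound u).
    destruct (Rle_dec 0 y) as [h|h].
    + exists (acos u). split; [lra|].
      unfold cis. rewrite cos_acos, sin_acos, <- hy, sqrt_Rsqr_abs by lra.
      rewrite Rabs_pos_eq by (apply Rdiv_le_0_compat; lra).
      unfold Cmult, RtoC, u; simpl. f_equal; field; lra.
    + exists (- acos u). split; [lra|].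
      unfold cis. rewrite cos_neg, sin_neg.
      rewrite cos_acos, sin_acos, <- hy, sqrt_Rsqr_abs by lra.
      rewrite Rabs_left1.
      * unfold Cmult, RtoC, u; simpl. f_equal; field; lra.
      * unfold Rdiv. pose proof (Rinv_0_lt_compat r hpos). nra.
Qed.

(** * Sums over roots of unity *)

Lemma sum_n_Cmult_l (c : C) (u : nat -> C) (N : nat) :
  sum_n (fun k => (c * u k)%C) N = (c * sum_n u N)%C.
Proof. exact (@sum_n_mult_l C_Ring c u N). Qed.

Lemma sum_n_Cmult_r (c : C) (u : nat -> C) (N : nat) :
  sum_n (fun k => (u k * c)%C) N = (sum_n u N * c)%C.
Proof. exact (@sum_n_mult_r C_Ring c u N). Qed.

Lemma sum_n_CS (u : nat -> C) (N : nat) :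
  sum_n u (S N) = (sum_n u N + u (S N))%C.
Proof. exact (sum_Sn u N). Qed.

Lemma sum_n_Cconj (u : nat -> C) (N : nat) :
  sum_n (fun k => Cconj (u k)) N = Cconj (sum_n u N).
Proof.
  induction N as [|N IH].
  - now rewrite !sum_O.
  - now rewrite !sum_n_CS, IH, Cplus_conj.
Qed.

Lemma fst_sum_n (u : nat -> C) (N : nat) :
  fst (sum_n u N) = sum_n (fun k => fst (u k)) N.
Proof.
  induction N as [|N IH].
  - now rewrite !sum_O.
  - rewrite sum_n_CS, sum_Sn, <- IH. reflexivity.
Qed.

Lemma sum_geometric (q : C) (N : nat) :
  ((q - 1) * sum_n (fun k => q ^ k) N = q ^ S N - 1)%C.
Proof.
  induction N as [|N IH].
  - rewrite sum_O. simpl. ring.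
  - rewrite sum_n_CS, Cmult_plus_distr_l, IH, !Cpow_S. ring.
Qed.

(** [cos t = 1 - 2 sin^2 (t / 2)], and [sin] is positive at [t / 2]. *)
Lemma cis_neq_1 (t : R) : 0 < t < 2 * PI -> cis t <> 1.
Proof.
  intros ht heq.
  assert (hc : cos t = 1) by exact (f_equal fst heq).
  assert (hs : 0 < sin (t / 2)) by (apply sin_gt_0; lra).
  replace t with (2 * (t / 2)) in hc by field.
  rewrite cos_2a_sin in hc. nra.
Qed.

Definition root_angle (N k : nat) : R := INR k * (2 * PI / INR (S N)).

(** This is a geometric sum whose ratio [cis t] is an [(N + 1)]-st root of unity,
    different from [1] because [0 < d < N + 1]. *)
Lemma sum_root_power (N d : nat) : (0 < d <= N)%nat ->
  sum_n (fun k => cis (root_angle N k) ^ d)%C N = RtoC 0.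
Proof.
  intros hd.
  assert (hN : 0 < INR (S N)) by (apply lt_0_INR; lia).
  pose proof PI_RGT_0 as hpi.
  set (t := INR d * (2 * PI / INR (S N))).
  assert (ht : 0 < t < 2 * PI).
  { assert (h1 : 0 < INR d) by (apply lt_0_INR; lia).
    assert (h2 : INR d < INR (S N)) by (apply lt_INR; lia).
    assert (hw : 0 < 2 * PI / INR (S N)) by (apply Rdiv_lt_0_compat; lra).
    split; unfold t; [nra|].
    replace (2 * PI) with (INR (S N) * (2 * PI / INR (S N))) at 2
      by (field; lra).
    nra. }
  rewrite (sum_n_ext _ (fun k => cis t ^ k)%C).
  2:{ intro k. rewrite !cis_pow. f_equal. unfold t, root_angle. ring. }
  pose proof (sum_geometric (cis t) N) as hg.
  assert (h1 : (cis t ^ S N)%C = 1).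
  { rewrite cis_pow.
    replace (INR (S N) * t) with (0 + 2 * INR d * PI)
      by (unfold t; field; lra).
    unfold cis. rewrite cos_period, sin_period, cos_0, sin_0. reflexivity. }
  rewrite h1 in hg.
  assert (hq : (cis t - 1)%C <> 0)
    by (apply Cminus_eq_contra, cis_neq_1, ht).
  rewrite <- (Cmult_1_l (sum_n _ N)), <- (Cinv_l _ hq), <- Cmult_assoc, hg.
  ring_in C.
Qed.

(** As conjugation inverts a point of the unit circle, the summand is the conjugate
    of the [(n - m)]-th power. *)
Lemma roots_orthogonal (N m n : nat) : (m < n <= N)%nat ->
  sum_n (fun k => cis (root_angle N k) ^ m * Cconj (cis (root_angle N k) ^ n))%C N
  = RtoC 0.
Proof.
  intros hmn.
  rewrite (sum_n_ext _
    (fun k => Cconj (cis (root_angle N k) ^ (n - m))%C)).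
  - rewrite sum_n_Cconj, sum_root_power by lia.
    unfold Cconj, RtoC; simpl. now rewrite Ropp_0.
  - intro k. set (w := cis (root_angle N k)).
    replace n with (m + (n - m))%nat at 1 by lia.
    rewrite Cpow_add_r, Cmult_conj, Cmult_assoc, <- Cmod2_conj.
    unfold w. rewrite Cmod_pow, Cmod_cis, pow1, pow1. ring_in C.
Qed.

Lemma Cmod_plus_sqr (u v : C) :
  Cmod (u + v) ^ 2 = Cmod u ^ 2 + Cmod v ^ 2 + 2 * fst (u * Cconj v)%C.
Proof.
  destruct u as [x y], v as [x' y'].
  unfold Cmod; rewrite !pow2_sqrt
    by (apply Rplus_le_le_0_compat; apply pow2_ge_0).
  simpl. ring.
Qed.

(** Pythagoras for vectors [phi n] of [C^(K+1)], pairwise orthogonal for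
    [n <= N]. Adding one vector at a time leaves a single cross term, whose sum
    vanishes by linearity; only the real part of the Hermitian product enters, so
    orthogonality for [m < n] is enough. *)
Lemma pythagoras (K : nat) (phi : nat -> nat -> C) (c : nat -> C) (N : nat) :
  (forall m n, (m < n <= N)%nat ->
     sum_n (fun k => phi m k * Cconj (phi n k))%C K = RtoC 0) ->
  sum_n (fun k => Cmod (sum_n (fun n => c n * phi n k)%C N) ^ 2) K =
  sum_n (fun n => Cmod (c n) ^ 2 * sum_n (fun k => Cmod (phi n k) ^ 2) K) N.
Proof.
  induction N as [|N IH]; intros horth.
  - rewrite sum_O, <- (sum_n_mult_l (K := R_Ring)).
    apply sum_n_ext. intro k.
    rewrite sum_O, Cmod_mult. apply Rpow_mult_distr.
  - rewrite sum_Sn, <- IH by (intros; apply horth; lia).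
    rewrite <- (sum_n_mult_l (K := R_Ring)), <- sum_n_plus.
    (* The cross terms of [Cmod_plus_sqr], summed over [k]. *)
    assert (hcross :
      sum_n (fun k => 2 * fst (sum_n (fun n => c n * phi n k)%C N *
                        Cconj (c (S N) * phi (S N) k))%C) K = 0).
    { rewrite (sum_n_mult_l (K := R_Ring)), <- fst_sum_n.
      rewrite (sum_n_ext _ (fun k => sum_n (fun n =>
        (c n * Cconj (c (S N))) * (phi n k * Cconj (phi (S N) k)))%C N)).
      - rewrite sum_n_switch.
        rewrite (sum_n_ext_loc _ (fun _ => RtoC 0)).
        + rewrite fst_sum_n. simpl. rewrite sum_n_const.
          change (2 * (INR (S N) * 0) = 0). ring.
        + intros n hn. rewrite sum_n_Cmult_l, horth by lia. ring_in C.
      - intro k. rewrite <- sum_n_Cmult_r. apply sum_n_ext. intro n.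
        rewrite Cmult_conj. ring_in C. }
    rewrite <- (Rplus_0_r (sum_n (fun k => plus _ _) K)), <- hcross.
    rewrite <- (sum_n_plus (G := R_AbelianMonoid)).
    apply sum_n_ext. intro k.
    rewrite sum_n_CS, Cmod_plus_sqr, (Cmod_mult (c (S N))), Rpow_mult_distr.
    reflexivity.
Qed.

(** * Partial sums of a power series *)

Definition partial_sum (a : nat -> C) (N : nat) (z : C) : C :=
  sum_n (fun n => z ^ n * a n)%C N.

Lemma partial_sum_parseval (a : nat -> C) (r : R) (N : nat) : 0 <= r ->
  sum_n (fun k => Cmod (partial_sum a N (r * cis (root_angle N k))) ^ 2) N =
  INR (S N) * sum_n (fun n => Cmod (a n) ^ 2 * r ^ (2 * n)) N.
Proof.
  intros hr.
  rewrite (sum_n_ext _ (fun k => Cmod (sum_n (fun n =>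
    (a n * RtoC r ^ n) * cis (root_angle N k) ^ n)%C N) ^ 2)).
  - rewrite (pythagoras N (fun n k => cis (root_angle N k) ^ n)%C).
    + rewrite <- (sum_n_mult_l (K := R_Ring)).
      apply sum_n_ext. intro n.
      rewrite (sum_n_ext _ (fun _ => 1)).
      * rewrite sum_n_const, Cmod_mult, Cmod_pow, Cmod_R, Rabs_pos_eq by exact hr.
        change mult with Rmult.
        rewrite Rpow_mult_distr, <- pow_mult, (Nat.mul_comm n 2). ring_in R.
      * intro k. rewrite Cmod_pow, Cmod_cis, !pow1. reflexivity.
    + intros m n hmn. now apply roots_orthogonal.
  - intro k. unfold partial_sum. do 2 f_equal.
    apply sum_n_ext. intro n. rewrite Cpow_mult_l. ring_in C.
Qed.

Lemma sum_sqr_le (a : nat -> C) (r B : R) (N : nat) : 0 <= r ->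
  (forall z, Cmod z = r -> Cmod (partial_sum a N z) <= B) ->
  sum_n (fun n => Cmod (a n) ^ 2 * r ^ (2 * n)) N <= B ^ 2.
Proof.
  intros hr hB.
  assert (hN : 0 < INR (S N)) by (apply lt_0_INR; lia).
  apply Rmult_le_reg_l with (INR (S N)); [exact hN|].
  rewrite <- partial_sum_parseval by exact hr.
  rewrite <- sum_n_const.
  apply sum_n_m_le. intro k.
  apply pow_incr. split; [apply Cmod_ge_0|].
  apply hB, Cmod_scal_cis, hr.
Qed.

(** [z^(n+1) - w^(n+1) = z (z^n - w^n) + (z - w) w^n]. *)
Lemma pow_lipschitz (r : R) (n : nat) : 0 <= r ->
  exists L, 0 <= L /\ forall z w, Cmod z <= r -> Cmod w <= r ->
    Cmod (z ^ n - w ^ n) <= L * Cmod (z - w).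
Proof.
  intros hr.
  induction n as [|n (L & hL & IH)].
  - exists 0. split; [lra|]. intros z w _ _. simpl.
    replace (1 - 1)%C with (RtoC 0) by ring. rewrite Cmod_0. lra.
  - pose proof (pow_le r n hr) as hrn.
    exists (r * L + r ^ n). split; [nra|]. intros z w hz hw.
    rewrite !Cpow_S.
    replace (z * z ^ n - w * w ^ n)%C
      with (z * (z ^ n - w ^ n) + (z - w) * w ^ n)%C by ring.
    eapply Rle_trans; [apply Cmod_triangle|].
    rewrite !Cmod_mult, Cmod_pow.
    specialize (IH z w hz hw).
    pose proof (pow_incr (Cmod w) r n (conj (Cmod_ge_0 w) hw)).
    pose proof (Cmod_ge_0 (z - w)).
    pose proof (Cmod_ge_0 (z ^ n - w ^ n)).
    pose proof (Cmod_ge_0 z).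
    nra.
Qed.

Lemma partial_sum_lipschitz (a : nat -> C) (r : R) (N : nat) : 0 <= r ->
  exists L, 0 <= L /\ forall z w, Cmod z <= r -> Cmod w <= r ->
    Cmod (partial_sum a N z - partial_sum a N w) <= L * Cmod (z - w).
Proof.
  intros hr. unfold partial_sum.
  induction N as [|N (L & hL & IH)].
  - exists 0. split; [lra|]. intros z w _ _. rewrite !sum_O. simpl.
    replace (1 * a 0%nat - 1 * a 0%nat)%C with (RtoC 0) by ring.
    rewrite Cmod_0. lra.
  - destruct (pow_lipschitz r (S N) hr) as (L' & hL' & hpow).
    pose proof (Cmod_ge_0 (a (S N))).
    exists (L + L' * Cmod (a (S N))). split; [nra|]. intros z w hz hw.
    rewrite !sum_n_CS.
    set (p := sum_n _ N). set (q := sum_n _ N).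
    replace (p + z ^ S N * a (S N) - (q + w ^ S N * a (S N)))%C
      with ((p - q) + (z ^ S N - w ^ S N) * a (S N))%C by ring.
    eapply Rle_trans; [apply Cmod_triangle|].
    rewrite Cmod_mult.
    specialize (IH z w hz hw). specialize (hpow z w hz hw).
    fold p q in IH. nra.
Qed.

Lemma is_pseries_eventually (a : nat -> C) (z l : C) (eps : R) :
  @is_pseries C_AbsRing C_NormedModule a z l -> 0 < eps ->
  eventually (fun N => Cmod (partial_sum a N z - l) < eps).
Proof.
  intros h heps.
  exact (proj1 (filterlim_locally_ball_norm _ _) h (mkposreal eps heps)).
Qed.

(** Convergence at [s] bounds the terms [a n * s ^ n], so the radius of convergence
    of the real series with coefficients [|a n|] is at least [s]. *)
Lemma pseries_abs_converges (a : nat -> C) (r s : R) (l : C) :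
  0 <= r < s -> @is_pseries C_AbsRing C_NormedModule a (RtoC s) l ->
  ex_series (fun n => Cmod (a n) * r ^ n).
Proof.
  intros hrs h.
  destruct (@filterlim_bounded C_AbsRing C_NormedModule _ (ex_intro _ l h))
    as [B hB].
  change (forall n, Cmod (partial_sum a n s) <= B) in hB.
  assert (hterm : forall n, Rabs (Cmod (a n) * s ^ n) <= 2 * B).
  { intro n.
    assert (hs : 0 <= s) by lra.
    rewrite Rabs_pos_eq
      by (apply Rmult_le_pos; [apply Cmod_ge_0 | now apply pow_le]).
    replace (Cmod (a n) * s ^ n) with (Cmod (RtoC s ^ n * a n))
      by (rewrite Cmod_mult, Cmod_pow, Cmod_R, Rabs_pos_eq by exact hs; ring).
    pose proof (Cmod_ge_0 (partial_sum a 0 s)) as h0.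
    pose proof (hB 0%nat) as hB0.
    destruct n as [|n].
    - unfold partial_sum in *. rewrite sum_O in *. lra.
    - replace (RtoC s ^ S n * a (S n))%C
        with (partial_sum a (S n) s + - partial_sum a n s)%C
        by (unfold partial_sum; rewrite sum_n_CS; ring).
      eapply Rle_trans; [apply Cmod_triangle|].
      rewrite Cmod_opp. pose proof (hB n). pose proof (hB (S n)). lra. }
  assert (hrad : Rbar_le s (CV_radius (fun n => Cmod (a n)))).
  { apply (proj1 (CV_radius_bounded _)). now exists (2 * B). }
  eapply ex_series_ext; [|apply (CV_disk_inside (fun n => Cmod (a n)) r)].
  - intro n. simpl. apply Rabs_pos_eq.
    apply Rmult_le_pos; [apply Cmod_ge_0 | apply pow_le; lra].
  - rewrite Rabs_pos_eq by lra.
    apply Rbar_lt_le_trans with (2 := hrad). simpl. lra.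
Qed.

Definition tail (a : nat -> C) (r : R) (N : nat) : R :=
  Series (fun n => Cmod (a n) * r ^ n) - sum_n (fun n => Cmod (a n) * r ^ n) N.

Lemma is_lim_seq_tail (a : nat -> C) (r : R) :
  ex_series (fun n => Cmod (a n) * r ^ n) -> is_lim_seq (tail a r) 0.
Proof.
  intros h. set (b := fun n => Cmod (a n) * r ^ n) in *.
  replace (Finite 0) with (Finite (Series b - Series b)) by (f_equal; ring).
  apply is_lim_seq_minus'.
  - apply is_lim_seq_const.
  - exact (Series_correct _ h).
Qed.

Lemma partial_sum_diff_le (a : nat -> C) (r : R) (z : C) (N p : nat) :
  Cmod z <= r ->
  Cmod (partial_sum a (N + p) z - partial_sum a N z) <=
  sum_n (fun n => Cmod (a n) * r ^ n) (N + p) - sum_n (fun n => Cmod (a n) * r ^ n) N.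
Proof.
  intros hz.
  induction p as [|p IH].
  - rewrite Nat.add_0_r, Rminus_diag. unfold Cminus.
    rewrite Cplus_opp_r, Cmod_0. lra.
  - rewrite Nat.add_succ_r. unfold partial_sum in *.
    rewrite sum_n_CS, sum_Sn. change plus with Rplus. cbv beta.
    set (u := sum_n _ (N + p)) in *. set (v := sum_n _ N) in *.
    set (s := sum_n _ (N + p)) in *. set (s' := sum_n _ N) in *.
    set (n := S (N + p)).
    replace (u + z ^ n * a n - v)%C with ((u - v) + z ^ n * a n)%C by ring.
    eapply Rle_trans; [apply Cmod_triangle|].
    rewrite Cmod_mult, Cmod_pow.
    pose proof (pow_incr (Cmod z) r n (conj (Cmod_ge_0 z) hz)).
    pose proof (Cmod_ge_0 (a n)).
    nra.
Qed.

(** Compare with a much later partial sum, which is within [eps] of [l]. The bound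
    does not depend on [z], which makes the convergence uniform on the disk. *)
Lemma partial_sum_approx (a : nat -> C) (r : R) (z l : C) (N : nat) :
  ex_series (fun n => Cmod (a n) * r ^ n) -> Cmod z <= r ->
  @is_pseries C_AbsRing C_NormedModule a z l ->
  Cmod (partial_sum a N z - l) <= tail a r N.
Proof.
  intros hb hz h.
  assert (hr : 0 <= r) by (pose proof (Cmod_ge_0 z); lra).
  apply Rle_plus_epsilon. intros eps heps.
  destruct (is_pseries_eventually a z l eps h heps) as [n0 hn0].
  specialize (hn0 (N + n0)%nat ltac:(lia)).
  replace (partial_sum a N z - l)%C with
    ((partial_sum a (N + n0) z - l) +
     - (partial_sum a (N + n0) z - partial_sum a N z))%C by ring.
  eapply Rle_trans; [apply Cmod_triangle|].
  rewrite Cmod_opp.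
  pose proof (partial_sum_diff_le a r z N n0 hz).
  assert (sum_n (fun n => Cmod (a n) * r ^ n) (N + n0) <=
          Series (fun n => Cmod (a n) * r ^ n)).
  { apply (is_lim_seq_incr_compare _ _ (Series_correct _ hb)).
    intro n. rewrite sum_Sn. change plus with Rplus.
    pose proof (Rmult_le_pos _ _ (Cmod_ge_0 (a (S n))) (pow_le r (S n) hr)).
    simpl in *. lra. }
  unfold tail. lra.
Qed.

(** * The maximum modulus *)

Lemma cis_continuous (t eps : R) : 0 < eps ->
  exists delta, 0 < delta /\
    forall s, Rabs (s - t) < delta -> Cmod (cis s - cis t) < eps.
Proof.
  intros heps.
  assert (heps2 : eps / 2 > 0) by lra.
  destruct (continuity_cos t (eps / 2) heps2) as (d1 & hd1 & h1).
  destruct (continuity_sin t (eps / 2) heps2) as (d2 & hd2 & h2).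
  exists (Rmin d1 d2). split; [now apply Rmin_pos|]. intros s hs.
  pose proof (Rmin_l d1 d2). pose proof (Rmin_r d1 d2).
  destruct (Req_dec t s) as [<-|hne].
  - unfold Cminus. rewrite Cplus_opp_r, Cmod_0. exact heps.
  - eapply Rle_lt_trans; [apply Cmod_le_Rabs|].
    assert (hD : D_x no_cond t s) by now split.
    assert (hs1 : Rabs (s - t) < d1) by lra.
    assert (hs2 : Rabs (s - t) < d2) by lra.
    pose proof (h1 s (conj hD hs1)) as h1'.
    pose proof (h2 s (conj hD hs2)) as h2'.
    change (Rabs (cos s - cos t) < eps / 2) in h1'.
    change (Rabs (sin s - sin t) < eps / 2) in h2'.
    change (Rabs (cos s - cos t) + Rabs (sin s - sin t) < eps). lra.
Qed.

Lemma Cmod_le_minus (u v : C) : Cmod u <= Cmod v + Cmod (u - v).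
Proof.
  replace u with (v + (u - v))%C at 1 by ring. apply Cmod_triangle.
Qed.

Lemma Cmod_minus_sym (u v : C) : Cmod (u - v) = Cmod (v - u).
Proof. rewrite <- Cmod_opp. f_equal. ring. Qed.

(** The usual three-part estimate for a uniform limit: choose [N] with tail below
    [eps / 3], then use that the [N]-th partial sum is Lipschitz on the disk. *)
Lemma modulus_continuous (a : nat -> C) (f : C -> C) (r t : R) :
  0 <= r -> ex_series (fun n => Cmod (a n) * r ^ n) ->
  (forall z, Cmod z = r -> @is_pseries C_AbsRing C_NormedModule a z (f z)) ->
  continuity_pt (fun t => Cmod (f (r * cis t)%C)) t.
Proof.
  intros hr hb hf eps heps.
  assert (heps3 : 0 < eps / 3) by lra.
  destruct (proj2 (is_lim_seq_spec _ _) (is_lim_seq_tail a r hb)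
              (mkposreal _ heps3)) as [N hN].
  specialize (hN N (Nat.le_refl N)). simpl in hN.
  apply Rabs_def2 in hN.
  destruct (partial_sum_lipschitz a r N hr) as (L & hL & hlip).
  (* [L * r] may vanish; adding [1] makes it a legitimate denominator. *)
  assert (hLr : 0 < L * r + 1) by nra.
  destruct (cis_continuous t (eps / 3 / (L * r + 1))) as (delta & hdelta & hc).
  { now apply Rdiv_lt_0_compat. }
  exists delta. split; [exact hdelta|]. intros s [_ hs].
  change (Rabs (s - t) < delta) in hs.
  change (Rabs (Cmod (f (r * cis s)%C) - Cmod (f (r * cis t)%C)) < eps).
  specialize (hc s hs).
  pose proof (Cmod_scal_cis r s hr) as hms.
  pose proof (Cmod_scal_cis r t hr) as hmt.
  pose proof (partial_sum_approx a r _ _ N hb (Req_le _ _ hms) (hf _ hms)) as has.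
  pose proof (partial_sum_approx a r _ _ N hb (Req_le _ _ hmt) (hf _ hmt)) as hat.
  pose proof (hlip _ _ (Req_le _ _ hms) (Req_le _ _ hmt)) as hst.
  replace (r * cis s - r * cis t)%C with (r * (cis s - cis t))%C in hst by ring.
  rewrite Cmod_mult, Cmod_R, Rabs_pos_eq in hst by exact hr.
  assert (hsmall : (L * r + 1) * Cmod (cis s - cis t) < eps / 3).
  { replace (eps / 3) with ((L * r + 1) * (eps / 3 / (L * r + 1)))
      by (field; lra).
    now apply Rmult_lt_compat_l. }
  pose proof (Cmod_ge_0 (cis s - cis t)).
  set (fs := f (r * cis s)%C) in *. set (ft := f (r * cis t)%C) in *.
  set (ps := partial_sum a N (r * cis s)) in *.
  set (pt := partial_sum a N (r * cis t)) in *.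
  assert (hdiff : Cmod (fs - ft) < eps).
  { replace (fs - ft)%C with (((ps - pt) + - (ps - fs)) + (pt - ft))%C by ring.
    eapply Rle_lt_trans; [apply Cmod_triangle|].
    pose proof (Cmod_triangle (ps - pt) (- (ps - fs))) as htri.
    rewrite Cmod_opp in htri.
    lra. }
  pose proof (Cmod_le_minus fs ft).
  pose proof (Cmod_le_minus ft fs).
  rewrite (Cmod_minus_sym ft fs) in *.
  apply Rabs_def1; lra.
Qed.

Lemma modulus_has_maximum (a : nat -> C) (f : C -> C) (r : R) :
  0 <= r -> ex_series (fun n => Cmod (a n) * r ^ n) ->
  (forall z, Cmod z = r -> @is_pseries C_AbsRing C_NormedModule a z (f z)) ->
  exists M, is_maximum (modulus_on_circle f r) M.
Proof.
  intros hr hb hf.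
  destruct (continuity_ab_maj (fun t => Cmod (f (r * cis t)%C)) (- PI) PI)
    as (t0 & hmax & _).
  - pose proof PI_RGT_0. lra.
  - intros t _. now apply modulus_continuous with a.
  - exists (Cmod (f (r * cis t0)%C)). split.
    + exists (r * cis t0)%C. split; [now apply Cmod_scal_cis | reflexivity].
    + intros y (z & hz & ->).
      destruct (polar_form z) as (t & ht & hzt).
      rewrite hz in hzt. rewrite hzt. now apply hmax.
Qed.

(** * The inequality *)

Theorem theorem3p3 (rho : R) (hrho : 0 < rho) (a : nat -> C) (f : C -> C)
  (hf : forall z : C, Cmod z < rho ->
     @is_pseries C_AbsRing C_NormedModule a z (f z))
  (r : R) (hr0 : 0 <= r) (hr : r < rho) :
  exists M : R,
    is_maximum (modulus_on_circle f r) M /\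
    ex_series (fun n : nat => (Cmod (a n))^2 * r^(2 * n)) /\
    Series (fun n : nat => (Cmod (a n))^2 * r^(2 * n)) <= M^2.
Proof.
  (* Absolute convergence at [r] needs convergence at a strictly larger radius. *)
  set (s := (r + rho) / 2).
  assert (hb : ex_series (fun n => Cmod (a n) * r ^ n)).
  { apply (pseries_abs_converges a r s (f s)).
    - unfold s; lra.
    - apply hf. rewrite Cmod_R, Rabs_pos_eq; unfold s; lra. }
  assert (hfr : forall z, Cmod z = r ->
    @is_pseries C_AbsRing C_NormedModule a z (f z))
    by (intros z hz; apply hf; lra).
  destruct (modulus_has_maximum a f r hr0 hb hfr) as [M hM].
  exists M. split; [exact hM|].
  set (S2 := sum_n (fun n => Cmod (a n) ^ 2 * r ^ (2 * n))).
  assert (hle : forall N, S2 N <= (M + tail a r N) ^ 2).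
  { intro N. apply sum_sqr_le; [exact hr0|]. intros z hz.
    eapply Rle_trans; [apply (Cmod_le_minus _ (f z))|].
    apply Rplus_le_compat.
    - apply hM. now exists z.
    - apply partial_sum_approx; [exact hb | lra | now apply hfr]. }
  assert (hlim : is_lim_seq (fun N => (M + tail a r N) ^ 2) (M ^ 2)).
  { replace (M ^ 2) with ((M + 0) * ((M + 0) * 1)) by ring.
    assert (h1 : is_lim_seq (fun N => M + tail a r N) (M + 0)).
    { apply is_lim_seq_plus'; [apply is_lim_seq_const|].
      now apply is_lim_seq_tail. }
    apply is_lim_seq_mult'; [exact h1|].
    apply is_lim_seq_mult'; [exact h1 | apply is_lim_seq_const]. }
  assert (hincr : forall N, S2 N <= S2 (S N)).
  { intro N. unfold S2. rewrite sum_Sn. change plus with Rplus.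
    pose proof (pow2_ge_0 (Cmod (a (S N)))).
    pose proof (pow_le r (2 * S N) hr0). cbv beta. nra. }
  destruct (@filterlim_bounded R_AbsRing R_NormedModule
    (fun N => (M + tail a r N) ^ 2) (ex_intro _ (M ^ 2) hlim)) as [B hB].
  assert (hbound : forall N, S2 N <= B).
  { intro N. eapply Rle_trans; [apply hle|].
    eapply Rle_trans; [apply Rle_abs | apply (hB N)]. }
  destruct (ex_finite_lim_seq_incr S2 B hincr hbound) as [l hl].
  split; [now exists l|].
  rewrite (is_series_unique _ l hl).
  exact (is_lim_seq_le _ _ l (M ^ 2) hle hl hlim).
Qed.
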